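(* For every $n\in\mathbb{N}$, $\varepsilon\in(0,1)$ and $A\in[1,\infty)$ there exists $N\in\mathbb{N}$ such that the following holds. For every normed space $X$ that is a direct sum $X=X_1\oplus X_2$ with both $X_1$ and $X_2$ (with the norms induced from $X$) isometric to $\ell_2^N$, and with both direct sum projections having norms $\le A$, there are $n$-dimensional subspaces $Y_1\subset X_1$ and $Y_2\subset X_2$ such that the norm on $Y_1\oplus Y_2$ induced from $X$ is $\varepsilon$-invariant.
   Context: All normed spaces are real. For a direct sum $X=X_1\oplus X_2$, the direct sum projections are the maps $P_1:X\to X_1$, $P_1(x_1+x_2)=x_1$, and $P_2:X\to X_2$, $P_2(x_1+x_2)=x_2$ ($x_1\in X_1$, $x_2\in X_2$). Let $Y_1\oplus Y_2$ be a direct sum endowed with a norm $\|\cdot\|$ whose restrictions to $Y_1$ and to $Y_2$ are Euclidean norms, and let $\varepsilon\in[0,1)$. The sum (or its norm) is called $\varepsilon$-invariant if for every orthogonal operator $O_1$ on $Y_1$, every orthogonal operator $O_2$ on $Y_2$, and all $y_1\in Y_1$, $y_2\in Y_2$, $$(1-\varepsilon)\|y_1+y_2\|\le\|O_1y_1+O_2y_2\|\le(1+\varepsilon)\|y_1+y_2\|.$$ *)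

(* Defs.v *)
From HB Require Import structures.
From mathcomp Require Import all_boot all_order all_algebra.
From mathcomp Require Import all_classical all_reals all_analysis.
Import Order.TTheory GRing.Theory Num.Theory.
Import numFieldNormedType.Exports.

Set Implicit Arguments.
Unset Strict Implicit.
Unset Printing Implicit Defensive.

Local Open Scope classical_set_scope.
Local Open Scope ring_scope.

(* The library norm on ['rV[R]_N] is the sup norm, hence this definition. *)
Definition l2norm (R : realType) (N : nat) (v : 'rV[R]_N) : R :=
  Num.sqrt (\sum_(i < N) v 0 i ^+ 2).

Section NormedSpace.
Context {R : realType} {X : normedModType R}.
Implicit Types (Y : set X) (O P : X -> X) (ip : X -> X -> R).

Definition linear_subspace Y : Prop := GRing.submod_closed [in Y].

Definition in_direct_sum (Y1 Y2 : set X) : Prop :=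
  [/\ linear_subspace Y1, linear_subspace Y2 & Y1 `&` Y2 = [set 0]].

Definition direct_sum_decomposition (X1 X2 : set X) : Prop :=
  in_direct_sum X1 X2 /\
  forall x, exists x1 x2, [/\ X1 x1, X2 x2 & x = x1 + x2].

Definition direct_sum_projections (X1 X2 : set X) (P1 P2 : X -> X) : Prop :=
  forall x1 x2, X1 x1 -> X2 x2 -> P1 (x1 + x2) = x1 /\ P2 (x1 + x2) = x2.

(* Valued in the extended reals, so that unbounded maps get norm [+oo]. *)
Definition opnorm P : \bar R :=
  ereal_sup [set `|P x|%:E | x in [set x : X | `|x| <= 1]].

Definition isometric_l2 (N : nat) Y : Prop :=
  exists f : {linear 'rV[R]_N -> X},
    (forall v, `|f v| = l2norm v) /\ range f = Y.

Definition subspace_of_dim (n : nat) Y : Prop :=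
  exists b : 'I_n -> X,
    (forall c : 'I_n -> R,
       \sum_(i < n) c i *: b i = 0 -> forall i, c i = 0) /\
    Y = [set y | exists c : 'I_n -> R, y = \sum_(i < n) c i *: b i].

(* Functions on a subspace [Y] are represented by functions on [X] of which
   only the restriction to [Y] matters. *)
Definition inner_product_on Y ip : Prop :=
  [/\ {in Y &, forall x y, ip x y = ip y x},
      forall a, {in Y & &, forall x y z,
        ip (a *: x + y) z = a * ip x z + ip y z}
    & {in Y, forall x : X, x != 0 -> 0 < ip x x}].

(* The restriction of the norm of [X] to [Y] is the Euclidean norm of [ip];
   this determines [ip] on [Y], by polarization. *)
Definition euclidean_on Y ip : Prop :=
  inner_product_on Y ip /\ {in Y, forall x, `|x| = Num.sqrt (ip x x)}.

Definition orthogonal_on Y ip O : Prop :=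
  [/\ forall a, {in Y &, forall x y, O (a *: x + y) = a *: O x + O y},
      O @` Y = Y
    & {in Y &, forall x y, ip (O x) (O y) = ip x y}].

Definition eps_invariant (eps : R) (Y1 Y2 : set X) : Prop :=
  in_direct_sum Y1 Y2 /\
  exists ip1 ip2 : X -> X -> R,
    [/\ euclidean_on Y1 ip1, euclidean_on Y2 ip2 &
      forall O1 O2 : X -> X,
        orthogonal_on Y1 ip1 O1 -> orthogonal_on Y2 ip2 O2 ->
        forall y1 y2, Y1 y1 -> Y2 y2 ->
          (1 - eps) * `|y1 + y2| <= `|O1 y1 + O2 y2| /\
          `|O1 y1 + O2 y2| <= (1 + eps) * `|y1 + y2|].

End NormedSpace.

(* Main.v *)
Require Import Defs.
From HB Require Import structures.
From mathcomp Require Import all_boot all_order all_algebra.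
From mathcomp Require Import all_classical all_reals all_analysis.
From mathcomp Require Import ring lra.
Import Order.TTheory GRing.Theory Num.Theory.
Import numFieldNormedType.Exports.

(** A random map [u |-> (<u, g_i> / sqrt N)_i], with independent [g_i] uniformly
distributed on a finite set [D] in [R^n], embeds [R^n] into each summand. Two
facts make the norm [Z] of a fixed pair [(u, v)] almost depend on the lengths
of [u] and [v] only.

Concentration: [Z] is a convex Lipschitz function of independent bounded
coordinates of size [1 / sqrt N], hence its variance is [O(1 / N)] by the
Efron-Stein inequality. Chebyshev's inequality on a finite net of pairs then
gives one embedding for which [Z] is close to its mean for all pairs.

Invariance of the mean: [D] is a cover of the unit sphere of minimal size, so by
Hall's theorem the images of [D] under any isometry can be matched with [D] up
to a small displacement, and relabelling the [g_i] along the matching changes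
[Z] by little. *)

Set Implicit Arguments.
Unset Strict Implicit.
Unset Printing Implicit Defensive.

Local Open Scope classical_set_scope.
Local Open Scope ring_scope.

(** * Hall's marriage theorem for finite relations *)

Section Hall.
Import boot.fintype boot.finset.
Variables (S T : finType) (r : S -> T -> bool).
Implicit Types (A C D : {set S}) (B : {set T}).

Definition neighbours B C : {set T} :=
  [set b in B | [exists a in C, r a b]].

Lemma neighboursP B C b :
  reflect (b \in B /\ exists2 a, a \in C & r a b) (b \in neighbours B C).
Proof.
rewrite inE; apply: (iffP andP) => [[bB /exists_inP[a aC rab]]|[bB [a aC rab]]].
  by split=> //; exists a.
by split=> //; apply/exists_inP; exists a.
Qed.

(** Induction on the size of [A]. If some proper nonempty [C] is tight, with at most [#|C|]
    neighbours, then [C] and [A :\: C] are matched separately. Otherwise every such subset has a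
    neighbour to spare, and any related pair may be matched and removed. [f0] is the default for
    empty [A]. *)
Lemma hall_marriage (f0 : S -> T) A B :
  (forall C, C \subset A -> (#|C| <= #|neighbours B C|)%N) ->
  exists f : S -> T,
    (forall a, a \in A -> f a \in B /\ r a (f a)) /\ {in A &, injective f}.
Proof.
have [k] := ubnP #|A|; elim: k A B => // k IH A B ltAk hallA.
have [->|[a aA]] := set_0Vmem A.
  by exists f0; split=> [x|x y]; rewrite inE.
have [/existsP[C /and4P[CA C0 CnA leC]]|/existsPn tight] := boolP
  [exists C : {set S}, [&& C \subset A, C != set0, C != A
                        & #|neighbours B C| <= #|C|]%N].
  have ltCA : C \proper A by rewrite properEneq CnA.
  have [f1 [f1P f1I]] : exists f : S -> T,
      (forall a, a \in C -> f a \in B /\ r a (f a)) /\ {in C &, injective f}.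
    apply: IH => [|E EC]; last by apply: hallA; apply: subset_trans CA.
    by apply: leq_trans (proper_card ltCA) _.
  have [f2 [f2P f2I]] : exists f : S -> T,
      (forall a, a \in A :\: C -> f a \in B :\: neighbours B C /\ r a (f a)) /\
      {in A :\: C &, injective f}.
    apply: IH => [|E EAC].
      rewrite cardsD (setIidPr CA) -ltnS; apply: leq_trans ltAk.
      by rewrite ltnS ltn_subrL !card_gt0 C0; apply/set0Pn; exists a.
    have EC : C :&: E = set0.
      apply/setP => x; rewrite !inE; apply/negP => /andP[xC /(subsetP EAC)].
      by rewrite in_setD xC.
    (* Hall's condition for [C :|: E], less the at most [#|C|] neighbours of [C], is the condition
       for [E] in the rest of [B]. *)
    have := hallA (C :|: E).
    rewrite subUset CA (subset_trans EAC (subsetDl _ _)) => /(_ isT).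
    rewrite cardsU EC cards0 subn0 => leCE.
    rewrite -(leq_add2l #|C|); apply: leq_trans leCE _.
    apply: (@leq_trans #|neighbours B C :|: neighbours (B :\: neighbours B C) E|).
      apply: subset_leq_card; apply/subsetP => b.
      move=> /neighboursP[bB [x + rxb]].
      rewrite !in_setU; have [//|nb] := boolP (b \in neighbours B C).
      case/orP => [xC|xE].
        by move/neighboursP: nb; case; split=> //; exists x.
      by apply/orP; right; apply/neighboursP; rewrite in_setD nb bB; split=> //; exists x.
    by apply: leq_trans (leq_card_setU _ _).1 _; rewrite leq_add2r.
  have f1N x : x \in C -> f1 x \in neighbours B C.
    by move=> xC; have [f1B rf] := f1P _ xC; apply/neighboursP; split=> //; exists x.
  have f2N x : x \in A -> x \notin C -> f2 x \notin neighbours B C.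
    by move=> xA xC; have := f2P x; rewrite !in_setD xA xC => /(_ isT)[/andP[]].
  exists (fun x => if x \in C then f1 x else f2 x); split=> [x xA|x y xA yA].
    have [/f1P//|xC] := boolP (x \in C).
    by have := f2P x; rewrite !in_setD xA xC => /(_ isT)[/andP[]].
  have [xC|xC] := boolP (x \in C); have [yC|yC] := boolP (y \in C).
  - exact: f1I.
  - by move=> e; have := f1N _ xC; rewrite e (negPf (f2N _ yA yC)).
  - by move=> e; have := f1N _ yC; rewrite -e (negPf (f2N _ xA xC)).
  - by apply: f2I; rewrite in_setD ?xC ?yC.
have /card_gt0P[b /neighboursP[bB [_ /set1P-> rab]]] :
    (0 < #|neighbours B [set a]|)%N.
  by apply: leq_trans (hallA _ _); rewrite ?cards1 ?sub1set.
have [f [fP fI]] : exists f : S -> T,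
    (forall x, x \in A :\ a -> f x \in B :\ b /\ r x (f x)) /\
    {in A :\ a &, injective f}.
  apply: IH => [|C CA].
    by move: ltAk; rewrite (cardsD1 a A) aA add1n ltnS.
  have [->|C0] := eqVneq C set0; first by rewrite cards0.
  have CsA : C \subset A := subset_trans CA (subD1set _ _).
  have CnA : C != A.
    by apply: contraTneq CA => ->; apply/subsetPn; exists a; rewrite ?inE ?eqxx.
  (* [C] has a neighbour to spare, which pays for the loss of [b]. *)
  have := tight C; rewrite CsA C0 CnA /= -ltnNge => ltC.
  rewrite -ltnS; apply: leq_trans ltC _.
  rewrite (cardsD1 b) -add1n leq_add ?leq_b1//; apply: subset_leq_card.
  apply/subsetP => c; rewrite in_setD1 => /andP[cb /neighboursP[cB cC]].
  by apply/neighboursP; rewrite in_setD1 cb.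
exists (fun x => if x == a then b else f x); split=> [x xA|x y xA yA].
  have [->//|xa] := eqVneq x a.
  by have := fP x; rewrite !in_setD1 xa xA => /(_ isT)[/andP[]].
have fb z : z \in A -> z != a -> f z != b.
  by move=> zA za; have := fP z; rewrite !in_setD1 za zA => /(_ isT)[/andP[]].
have [->|xa] := eqVneq x a; have [->|ya] := eqVneq y a => //.
- by move=> e; have := fb _ yA ya; rewrite -e eqxx.
- by move=> e; have := fb _ xA xa; rewrite e eqxx.
- by apply: fI; rewrite in_setD1 ?xa ?ya.
Qed.

End Hall.

(** * Euclidean geometry of row vectors and reflections *)

Section Euclid.
Variables (R : realType) (n : nat).
Implicit Types (u v w x y : 'rV[R]_n).

Definition dot u v : R := \sum_i u 0 i * v 0 i.

Lemma dotC u v : dot u v = dot v u.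
Proof. by apply: eq_bigr => i _; rewrite mulrC. Qed.

Lemma dotDl u v w : dot (u + v) w = dot u w + dot v w.
Proof. by rewrite -big_split; apply: eq_bigr => i _; rewrite !mxE mulrDl. Qed.

Lemma dotZl a u v : dot (a *: u) v = a * dot u v.
Proof. by rewrite mulr_sumr; apply: eq_bigr => i _; rewrite !mxE mulrA. Qed.

Lemma dotDr u v w : dot u (v + w) = dot u v + dot u w.
Proof. by rewrite !(dotC u) dotDl. Qed.

Lemma dotZr a u v : dot u (a *: v) = a * dot u v.
Proof. by rewrite !(dotC u) dotZl. Qed.

Lemma dotBl u v w : dot (u - v) w = dot u w - dot v w.
Proof. by rewrite -scaleN1r dotDl dotZl mulN1r. Qed.

Lemma dotBr u v w : dot u (v - w) = dot u v - dot u w.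
Proof. by rewrite !(dotC u) dotBl. Qed.

Lemma dot_ge0 u : 0 <= dot u u.
Proof. by apply: sumr_ge0 => i _; rewrite -expr2 sqr_ge0. Qed.

Lemma dot_eq0 u : dot u u = 0 -> u = 0.
Proof.
move=> /eqP; rewrite psumr_eq0 => [/allP u0|i _]; last by rewrite -expr2 sqr_ge0.
apply/rowP => i; rewrite mxE; apply/eqP.
by have := u0 i (mem_index_enum i); rewrite /= -expr2 sqrf_eq0.
Qed.

Lemma l2normE u : l2norm u = Num.sqrt (dot u u).
Proof. by congr Num.sqrt; apply: eq_bigr => i _; rewrite expr2. Qed.

Lemma l2norm_ge0 u : 0 <= l2norm u. Proof. exact: sqrtr_ge0. Qed.

Lemma l2norm_sqr u : l2norm u ^+ 2 = dot u u.
Proof. by rewrite l2normE sqr_sqrtr ?dot_ge0. Qed.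

Lemma l2norm0 : l2norm (0 : 'rV[R]_n) = 0.
Proof. by rewrite l2normE /dot big1 ?sqrtr0// => i _; rewrite mxE mul0r. Qed.

Lemma l2norm_eq0 u : l2norm u = 0 -> u = 0.
Proof. by move=> u0; apply: dot_eq0; rewrite -l2norm_sqr u0 expr0n. Qed.

Lemma l2normZ a u : l2norm (a *: u) = `|a| * l2norm u.
Proof.
by rewrite !l2normE dotZl dotZr mulrA -expr2 sqrtrM ?sqr_ge0// sqrtr_sqr.
Qed.

Lemma l2norm_dist u v : l2norm (u - v) = l2norm (v - u).
Proof. by rewrite -opprB -scaleN1r l2normZ normrN1 mul1r. Qed.

Lemma l2norm_delta (j : 'I_n) : l2norm (delta_mx 0 j : 'rV[R]_n) = 1.
Proof.
rewrite l2normE /dot (bigD1 j)//= big1 => [|i /negPf ni].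
  by rewrite !mxE !eqxx mulr1 addr0 sqrtr1.
by rewrite !mxE ni andbF mulr0.
Qed.

(** Cauchy-Schwarz: expand the square of [dot v v *: u - dot u v *: v] and divide by [dot v v]. *)
Lemma dot_le u v : `|dot u v| <= l2norm u * l2norm v.
Proof.
rewrite -(@ler_pXn2r _ 2)// ?nnegrE ?mulr_ge0 ?l2norm_ge0//.
rewrite real_normK ?num_real// exprMn !l2norm_sqr.
have [v0|v0] := eqVneq (dot v v) 0.
  by rewrite (dot_eq0 v0) -(scale0r 0) !dotZr !mul0r expr0n mulr0.
have vgt0 : 0 < dot v v by rewrite lt_def v0 dot_ge0.
have := dot_ge0 (dot v v *: u - dot u v *: v).
rewrite dotBl !dotBr !dotZl !dotZr (dotC v u).
set a := dot u v; set b := dot v v in vgt0 *; set c := dot u u => h.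
rewrite -subr_ge0 -(pmulr_rge0 _ vgt0); lra.
Qed.

Lemma ler_l2normD u v : l2norm (u + v) <= l2norm u + l2norm v.
Proof.
rewrite -(@ler_pXn2r _ 2)// ?nnegrE ?addr_ge0 ?l2norm_ge0//.
rewrite l2norm_sqr dotDl !dotDr (dotC v u) -!l2norm_sqr.
have := le_trans (ler_norm _) (dot_le u v); lra.
Qed.

Lemma ler_l2norm_dist w u v : l2norm (u - v) <= l2norm (u - w) + l2norm (w - v).
Proof. by rewrite (le_trans _ (ler_l2normD _ _))// addrA subrK. Qed.

(* For [w = 0] this is the identity, since [0^-1 = 0]. *)
Definition reflection w x := x - (2 * dot x w / dot w w) *: w.

Lemma dot_reflectionl w x y : dot (reflection w x) y = dot x (reflection w y).
Proof. by rewrite dotBl dotBr dotZl dotZr (dotC w y); ring. Qed.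

Lemma reflectionK w : involutive (reflection w).
Proof.
move=> x; rewrite /reflection dotBl dotZl.
have [w0|w0] := eqVneq (dot w w) 0.
  by rewrite w0 invr0 !mulr0 !scale0r !subr0.
by rewrite divfK//; apply/rowP => i; rewrite !mxE; field.
Qed.

Lemma dot_reflection w x y : dot (reflection w x) (reflection w y) = dot x y.
Proof. by rewrite dot_reflectionl reflectionK. Qed.

Lemma l2norm_reflection w x : l2norm (reflection w x) = l2norm x.
Proof. by rewrite !l2normE dot_reflection. Qed.

Lemma reflectionB w x y : reflection w (x - y) = reflection w x - reflection w y.
Proof.
by rewrite /reflection dotBl; apply/rowP => i; rewrite !mxE; ring.
Qed.

(** Equal lengths give <x - y, x - y> = 2 <x, x - y>, so the coefficient in the reflection is 1.
    This supplies an isometry between any two vectors of equal length. *)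
Lemma reflection_swap x y : l2norm x = l2norm y -> reflection (x - y) x = y.
Proof.
move=> exy; have e : dot x x = dot y y by rewrite -!l2norm_sqr exy.
have eD : dot (x - y) (x - y) = 2 * dot x (x - y).
  by rewrite dotBl !dotBr (dotC y x) e; ring.
rewrite /reflection -eD.
have [d0|d0] := eqVneq (dot (x - y) (x - y)) 0.
  by rewrite d0 mul0r scale0r subr0; apply/eqP; rewrite -subr_eq0; apply/eqP/dot_eq0.
by rewrite divff// scale1r subKr.
Qed.

End Euclid.

(** * Finite nets of the ball and minimal covers of the sphere *)

Section Nets.
Variables (R : realType) (n : nat).
Implicit Types (u v x y : 'rV[R]_n) (D : seq 'rV[R]_n).

Lemma l2norm_le (c b : R) v : 0 <= b -> n%:R * c ^+ 2 <= b ^+ 2 ->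
  (forall i, `|v 0 i| <= c) -> l2norm v <= b.
Proof.
move=> b0 cb vc; rewrite -(@ler_pXn2r _ 2)// ?nnegrE ?l2norm_ge0//.
rewrite l2norm_sqr; apply: le_trans cb.
rewrite -[n in n%:R]card_ord -sumr_const mulr_suml ler_sum// => i _.
by rewrite mul1r -expr2 -real_normK ?num_real// lerXn2r ?nnegrE ?(le_trans _ (vc i)).
Qed.

Lemma coord_le_l2norm v i : `|v 0 i| <= l2norm v.
Proof.
rewrite -(@ler_pXn2r _ 2)// ?nnegrE ?l2norm_ge0// l2norm_sqr real_normK ?num_real//.
rewrite /dot (bigD1 i)//= -expr2 lerDl sumr_ge0// => j _.
by rewrite -expr2 sqr_ge0.
Qed.

(** The points of [D] may lie outside [P]: grid points may leave the ball, and cover points need not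
    lie on the sphere. *)
Definition covers (P : set 'rV[R]_n) (delta : R) D :=
  forall x, P x -> exists2 d, d \in D & l2norm (x - d) <= delta.

Lemma ball_net delta : 0 < delta ->
  exists D, covers [set x | l2norm x <= 1] delta D.
Proof.
(* Grid of mesh 1/L in the cube [-1, 1]^n: rounding the coordinates down moves a point by at most
   sqrt n / L <= n / L <= delta. *)
move=> delta0; pose L := (Num.truncn (n%:R / delta)).+1.
have L0 : 0 < L%:R :> R by rewrite ltr0n.
have nL : n%:R / L%:R <= delta.
  rewrite ler_pdivrMr// mulrC -ler_pdivrMr//.
  by rewrite ltW// truncnS_gt.
exists [seq \row_i ((f i : nat)%:R / L%:R - 1) | f : {ffun 'I_n -> 'I_(2 * L).+1}].
move=> x /= x1.
have xB i : 0 <= L%:R * (x 0 i + 1) <= (2 * L)%:R.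
  have := le_trans (coord_le_l2norm x i) x1; rewrite ler_norml => /andP[x0 xl].
  by rewrite natrM mulr_ge0 ?(ltW L0)//=; [rewrite mulrC ler_pM2r//|]; lra.
pose k i := Num.truncn (L%:R * (x 0 i + 1)).
have kP i : (k i)%:R <= L%:R * (x 0 i + 1) < (k i).+1%:R.
  by apply: truncn_itv; have /andP[] := xB i.
have kL i : (k i < (2 * L).+1)%N.
  rewrite ltnS -(@ler_nat R); apply: le_trans (proj2 (andP (xB i))).
  by have /andP[] := kP i.
exists (\row_i (([ffun i => Ordinal (kL i)] i : nat)%:R / L%:R - 1)).
  by apply/mapP; exists [ffun i => Ordinal (kL i)]; rewrite ?mem_enum.
apply: (@l2norm_le L%:R^-1) => [|| i]; first exact: ltW.
  apply: (@le_trans _ _ ((n%:R / L%:R) ^+ 2)).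
    rewrite exprMn ler_wpM2r ?sqr_ge0// -natrX ler_nat.
    by case: (n) => // m; rewrite -mulnn leq_pmull.
  by rewrite lerXn2r ?nnegrE ?(ltW delta0)// divr_ge0// ltW.
rewrite !mxE ffunE /= -(ler_pM2l L0) mulfV ?gt_eqF//.
rewrite -[X in X * `|_|]gtr0_norm// -normrM.
rewrite (_ : _ * _ = L%:R * (x 0 i + 1) - (k i)%:R); last first.
  by field; rewrite gt_eqF.
have /andP[k1] := kP i; rewrite -natr1 => k2.
rewrite ger0_norm; lra.
Qed.

(* Any two covers of minimal size can be matched, by Hall's theorem: if the
   neighbours of a subset of one cover were fewer than the subset, then
   replacing the subset by its neighbours would give a smaller cover. *)
Lemma sphere_design delta : 0 < delta ->
  exists M (g : 'I_M -> 'rV[R]_n),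
    [/\ (0 < n)%N -> (0 < M)%N,
        forall i, 1 - delta <= l2norm (g i) <= 1 + delta
      & forall u v, l2norm u = l2norm v ->
          exists2 p : 'I_M -> 'I_M, injective p &
            forall i, `|dot u (g i) - dot v (g (p i))| <= 2 * delta * l2norm u].
Proof.
move=> delta0; pose S := [set x : 'rV[R]_n | l2norm x = 1].
have exM : exists M, `[< exists2 D, size D = M & covers S delta D >].
  have [D Dc] := ball_net delta0; exists (size D); apply/asboolP; exists D => //.
  by move=> x x1; apply: Dc; rewrite /= x1.
case: (ex_minnP exM) => _ /asboolP[D <- Dc] minM.
have {minM} minD D' : covers S delta D' -> (size D <= size D')%N.
  by move=> D'c; apply: minM; apply/asboolP; exists D'.
pose g (i : 'I_(size D)) := D`_i.
have Dg d : d \in D -> exists i, d = g i.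
  by move=> dD; have := dD; rewrite -index_mem => h; exists (Ordinal h); rewrite /g nth_index.
exists (size D), g; split.
- by move=> n0; have [d] := Dc _ (l2norm_delta R (Ordinal n0)); case: (D).
- move=> i.
  (* Minimality: if no sphere point were within [delta] of [g i], dropping [g i] would leave a
     smaller cover. *)
  have [x x1 xg] : exists2 x, S x & l2norm (x - g i) <= delta.
    apply: contrapT => nx.
    have : covers S delta [seq g j | j in predC1 i].
      move=> x xS; have [d dD xd] := Dc _ xS; have [j dj] := Dg _ dD.
      exists d => //; rewrite dj; apply: map_f; rewrite mem_enum inE.
      by apply: contra_notN nx => /eqP <-; exists x; rewrite -?dj.
    move/minD; rewrite size_map -cardE cardC1 card_ord.
    by rewrite -ltnS prednK ?ltnn// (leq_ltn_trans _ (ltn_ord i)).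
  have h1 := ler_l2normD (x - g i) (g i).
  have h2 := ler_l2normD (g i - x) x.
  by rewrite !subrK x1 (l2norm_dist _ x) in h1 h2; apply/andP; split; lra.
move=> u v uv; pose s := reflection (u - v).
pose r i j := l2norm (g i - s (g j)) <= 2 * delta.
have [p [pr pI]] : exists p : 'I_(size D) -> 'I_(size D),
    (forall i, i \in [set: 'I_(size D)]%SET ->
       p i \in [set: 'I_(size D)]%SET /\ r i (p i)) /\
    {in [set: 'I_(size D)]%SET &, injective p}.
  apply: (hall_marriage id) => C _.
  set NC := neighbours _ _ _.
  have /minD : covers S delta
      ([seq g j | j in ~: C] ++ [seq s (g j) | j in NC])%SET.
    move=> x xS; have [d dD xd] := Dc _ xS; have [i di] := Dg _ dD.
    have [iC|iC] := boolP (i \in C); last first.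
      by exists d => //; rewrite mem_cat di map_f// mem_enum inE.
    (* The point covering the reflection of [x], reflected back, covers [x]. It is within
       [2 * delta] of [g i], so its index lies in [NC]. *)
    have sxS : S (s x) by rewrite /S /= l2norm_reflection.
    have [d' d'D xd'] := Dc _ sxS; have [j dj] := Dg _ d'D.
    have xj : l2norm (x - s (g j)) <= delta.
      by rewrite -(reflectionK (u - v) x) -reflectionB l2norm_reflection -dj.
    exists (s (g j)) => //; rewrite mem_cat (map_f (fun j => s (g j))) ?orbT//.
    rewrite mem_enum; apply/neighboursP; rewrite finset.in_setT; split=> //; exists i => //.
    rewrite /r -di; have := ler_l2norm_dist x d (s (g j)).
    by rewrite (l2norm_dist d x); lra.
  rewrite size_cat !size_map -!cardE -[X in (X <= _)%N](card_ord (size D)).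
  by rewrite -(cardsC C) addnC leq_add2l.
exists p => [i j|i]; first by apply: pI; rewrite finset.in_setT.
have [_ rp] := pr i (finset.in_setT _).
have -> : dot v (g (p i)) = dot u (s (g (p i))).
  by rewrite -{1}(reflection_swap uv) dot_reflectionl.
rewrite -dotBr; apply: le_trans (dot_le _ _) _.
by rewrite mulrC ler_wpM2r ?l2norm_ge0.
Qed.

End Nets.

(** * The Efron-Stein inequality on a finite product space *)

Section EfronStein.
Variables (R : realType) (T : finType) (N : nat).
Local Notation Omega := {ffun 'I_N -> T}.
Implicit Types (f : Omega -> R) (x y : Omega) (p : Omega * Omega).

Definition mean f : R := (\sum_x f x) / #|Omega|%:R.

(** Resampling of the coordinates in [P], encoded as a permutation of pairs so that sums over pairs
    are invariant. *)
Definition swap_at (P : pred 'I_N) p : Omega * Omega :=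
  ([ffun i => if P i then p.2 i else p.1 i],
   [ffun i => if P i then p.1 i else p.2 i]).

Lemma swap_atK P : involutive (swap_at P).
Proof.
case=> x y; rewrite /swap_at; congr (_, _); apply/ffunP => i; rewrite !ffunE /=;
by case: (P i).
Qed.

Lemma swap_atC P Q p : swap_at P (swap_at Q p) = swap_at Q (swap_at P p).
Proof.
rewrite /swap_at; congr (_, _); apply/ffunP => i; rewrite !ffunE /=;
by case: (P i); case: (Q i).
Qed.

Lemma reindex_swap_at P (F : Omega * Omega -> R) :
  \sum_p F (swap_at P p) = \sum_p F p.
Proof. by rewrite [RHS](reindex_inj (inv_inj (swap_atK P))). Qed.

(** For independent x and y, E f(x) (f(x) - f(y)) = Var f; both sides are multiplied by the square
    of [#|Omega|]. *)
Lemma pair_sum_mean f :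
  \sum_p f p.1 * (f p.1 - f p.2) = #|Omega|%:R * \sum_x (f x - mean f) ^+ 2.
Proof.
have [om0|om0] := eqVneq #|Omega| 0%N.
  rewrite om0 mul0r big1 // => -[x y] _.
  by have := fintype0 x; rewrite om0 => /(_ erefl).
have sumE : \sum_x f x = #|Omega|%:R * mean f.
  by rewrite mulrC divfK// pnatr_eq0.
rewrite -(pair_bigA _ (fun x y => f x * (f x - f y)))/=.
transitivity (\sum_x (#|Omega|%:R * f x ^+ 2 - f x * \sum_y f y)).
  apply: eq_bigr => x _; rewrite -mulr_sumr big_split sumr_const sumrN /=.
  by rewrite -mulr_natl; ring.
rewrite big_split -mulr_sumr sumrN -mulr_suml /=.
have -> : \sum_x (f x - mean f) ^+ 2 =
    \sum_x f x ^+ 2 - 2 * mean f * \sum_x f x + #|Omega|%:R * mean f ^+ 2.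
  transitivity (\sum_x (f x ^+ 2 - 2 * mean f * f x + mean f ^+ 2)).
    by apply: eq_bigr => x _; ring.
  by rewrite big_split sumrB sumr_const -mulr_sumr (mulr_natl _ #|_|).
by rewrite sumE; ring.
Qed.

(** The difference f x - f y telescopes through hybrids exchanging the first k coordinates.
    Antisymmetry under exchange of the [k]-th coordinates turns each term into a product of two
    increments, bounded by their squares. The same antisymmetry lets the hypothesis mention
    decrements only, which convexity controls. *)
Lemma efron_stein f (C : R) :
  (forall x y, \sum_k Num.max 0
     (f x - f [ffun i => if i == k then y i else x i]) ^+ 2 <= C) ->
  \sum_x (f x - mean f) ^+ 2 <= #|Omega|%:R * C.
Proof.
move=> fC.
have [om0|om0] := posnP #|Omega|.
  rewrite om0 mul0r big1 // => x _.
  by have := fintype0 x; rewrite om0 => /(_ erefl).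
have om0' : 0 < #|Omega|%:R :> R by rewrite ltr0n.
rewrite -(ler_pM2l om0') -pair_sum_mean.
pose b k p := f p.1 - f (swap_at (pred1 k) p).1.
pose h k := swap_at (fun i : 'I_N => (i < k)%N).
have bN k p : b k (swap_at (pred1 k) p) = - b k p.
  by rewrite /b swap_atK opprB.
have telescope p : f p.1 - f p.2 = \sum_(k < N) b k (h k p).
  have hS (k : 'I_N) : swap_at (pred1 k) (h k p) = h k.+1 p.
    congr (_, _); apply/ffunP => i; rewrite !ffunE /= ltnS (leq_eqVlt i) val_eqE;
    by have [->|_] := eqVneq i k; rewrite ?ltnn.
  under eq_bigr do rewrite /b hS.
  rewrite -(big_mkord xpredT (fun k => f (h k p).1 - f (h k.+1 p).1)).
  under eq_bigr do rewrite -opprB; rewrite sumrN telescope_sumr// opprB.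
  by congr (f _ - f _); apply/ffunP => i; rewrite ffunE /= ?ltn_ord.
under eq_bigr do rewrite telescope mulr_sumr.
rewrite exchange_big /=.
apply: (@le_trans _ _ (\sum_(k < N) \sum_p Num.max 0 (b k p) ^+ 2)); last first.
  rewrite exchange_big /= mulrA -natrM -card_prod -[X in X%:R * C]sum1_card.
  rewrite natr_sum mulr_suml ler_sum// => p _; rewrite mul1r.
  exact: fC.
(* Exchanging the [k]-th coordinates of the pair changes the sign of the [k]-th
   hybrid increment. *)
apply: ler_sum => k _; set s := swap_at (pred1 k).
have hb : \sum_p f p.1 * b k (h k p) = - \sum_p f (s p).1 * b k (h k p).
  rewrite -(reindex_swap_at (pred1 k)) -sumrN; apply: eq_bigr => p _.
  by rewrite /h swap_atC bN mulrN.
(* The exchange negates [b k], so its positive part carries half of the sum of squares. *)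
have b2 : \sum_p b k p ^+ 2 = 2 * \sum_p Num.max 0 (b k p) ^+ 2.
  rewrite mulr_natl mulr2n -[X in _ + X](reindex_swap_at (pred1 k)) -big_split /=.
  apply: eq_bigr => p _; rewrite bN !maxEle oppr_ge0.
  by case: (ltgtP 0 (b k p)) => [?|?|<-]; ring.
have bh : \sum_p b k (h k p) ^+ 2 = \sum_p b k p ^+ 2.
  exact: (reindex_swap_at _ (fun p => b k p ^+ 2)).
have bb : 2 * \sum_p b k p * b k (h k p) <=
    \sum_p b k p ^+ 2 + \sum_p b k (h k p) ^+ 2.
  rewrite -big_split mulr_sumr ler_sum// => p _ /=.
  by have := sqr_ge0 (b k p - b k (h k p)); rewrite sqrrB; lra.
(* By [hb] the right-hand side is twice the sum to be bounded. *)
have : \sum_p b k p * b k (h k p) =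
    \sum_p f p.1 * b k (h k p) - \sum_p f (s p).1 * b k (h k p).
  by rewrite -sumrB; apply: eq_bigr => p _; rewrite -mulrBl.
lra.
Qed.

End EfronStein.

(** * A convexity bound for decrements of a norm *)

Section NormDrop.
Variables (R : realType) (X : normedModType R) (N : nat).

(* Convexity bounds the decrements of the norm along the [d i] by its decrement
   along a single combination of them. *)
Lemma norm_drop_sqr (x : X) (d : 'I_N -> X) (L : R) : 0 <= L ->
  (forall w : 'rV[R]_N, `|\sum_i w 0 i *: d i| <= L * l2norm w) ->
  \sum_i Num.max 0 (`|x| - `|x - d i|) ^+ 2 <= L ^+ 2.
Proof.
(* The drops themselves serve as weights, so the weighted drop is [l2norm w ^+ 2]. *)
move=> L0 dL; pose w : 'rV[R]_N := \row_i Num.max 0 (`|x| - `|x - d i|).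
have w0 i : 0 <= w 0 i by rewrite mxE le_max lexx.
have wx i : w 0 i * `|x - d i| = w 0 i * `|x| - w 0 i ^+ 2.
  by rewrite mxE maxEle; case: ifP => _; ring.
have -> : \sum_i Num.max 0 (`|x| - `|x - d i|) ^+ 2 = l2norm w ^+ 2.
  by rewrite l2norm_sqr; apply: eq_bigr => i _; rewrite !mxE expr2.
(* Scaling by [s] keeps [1 - s * sigma] nonnegative, so [e] exhibits a convex combination of [x] and
   the [x - d i]; the added 1 covers [sigma = 0]. *)
pose sigma := \sum_i w 0 i; pose s := (sigma + 1)^-1.
have sigma0 : 0 <= sigma by apply: sumr_ge0.
have s0 : 0 < s by rewrite invr_gt0; lra.
have ssigma : s * sigma <= 1 by rewrite mulrC ler_pdivrMr; lra.
have e : x - s *: (\sum_i w 0 i *: d i) =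
    (1 - s * sigma) *: x + s *: \sum_i w 0 i *: (x - d i).
  under [X in _ = _ + _ *: X]eq_bigr do rewrite scalerBr.
  rewrite big_split /= sumrN -scaler_suml scalerDr scalerA addrA scalerN.
  by rewrite -scalerDl subrK scale1r.
have up : `|x - s *: (\sum_i w 0 i *: d i)| <= `|x| - s * l2norm w ^+ 2.
  rewrite e; apply: le_trans (ler_normD _ _) _.
  rewrite !normrZ ger0_norm ?subr_ge0// (gtr0_norm s0).
  have : `|\sum_i w 0 i *: (x - d i)| <= sigma * `|x| - l2norm w ^+ 2.
    apply: le_trans (ler_norm_sum _ _ _) _.
    rewrite l2norm_sqr mulr_suml -sumrB ler_sum// => i _.
    by rewrite normrZ ger0_norm// wx expr2.
  by rewrite -(ler_pM2l s0); lra.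
have lo : `|x| - s * (L * l2norm w) <= `|x - s *: (\sum_i w 0 i *: d i)|.
  apply: le_trans (lerB_dist _ _).
  by rewrite lerD2l lerN2 normrZ (gtr0_norm s0) ler_pM2l.
have : l2norm w ^+ 2 <= L * l2norm w by rewrite -(ler_pM2l s0); lra.
have := l2norm_ge0 w; set q := l2norm w => q0 qL.
have [q1|q1] := lerP q L; last by nra.
by rewrite lerXn2r ?nnegrE.
Qed.

End NormDrop.

(** * Means over the product space and a union bound *)

Section Mean.
Variables (R : realType) (T : finType) (N : nat).
Local Notation Omega := {ffun 'I_N -> T}.
Implicit Types f : Omega -> R.

Lemma ler_mean_dist f f' (c : R) : 0 <= c ->
  (forall x, `|f x - f' x| <= c) -> `|mean f - mean f'| <= c.
Proof.
move=> c0 ff'; rewrite /mean -mulrBl -sumrB normrM normfV normr_nat.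
have [om0|om0] := posnP #|Omega|; first by rewrite om0 invr0 mulr0.
rewrite ler_pdivrMr ?ltr0n//; apply: le_trans (ler_norm_sum _ _ _) _.
apply: le_trans (ler_sum _ (fun x _ => ff' x)) _.
by rewrite sumr_const mulr_natr.
Qed.

Lemma mean_reindex f (p : Omega -> Omega) : injective p ->
  mean (fun x => f (p x)) = mean f.
Proof. by move=> pI; rewrite /mean [in RHS](reindex_inj pI). Qed.

(** Chebyshev's inequality with a union bound: if every [x] failed for some [q], the squared
    deviations summed over [r] would be at least [kappa ^+ 2] at every [x], against their
    average. *)
Lemma near_means (Q : eqType) (r : seq Q) (Z : Q -> Omega -> R)
    (C : Q -> R) (kappa : R) : 0 <= kappa -> (0 < #|Omega|)%N ->
  (forall q, \sum_x (Z q x - mean (Z q)) ^+ 2 <= #|Omega|%:R * C q) ->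
  \sum_(q <- r) C q < kappa ^+ 2 ->
  exists x, forall q, q \in r -> `|Z q x - mean (Z q)| <= kappa.
Proof.
move=> kappa0 om0 ZC Ck; apply: contrapT => nx.
have big x : kappa ^+ 2 <= \sum_(q <- r) (Z q x - mean (Z q)) ^+ 2.
  apply: contrapT => /negP; rewrite -ltNge => lt; apply: nx; exists x => q qr.
  rewrite -(@ler_pXn2r _ 2)// ?nnegrE// real_normK ?num_real//.
  apply: le_trans (ltW lt); rewrite (big_rem q)//= lerDl sumr_ge0// => *.
  exact: sqr_ge0.
have : #|Omega|%:R * kappa ^+ 2 <= #|Omega|%:R * \sum_(q <- r) C q.
  apply: (@le_trans _ _ (\sum_(x : Omega) \sum_(q <- r) (Z q x - mean (Z q)) ^+ 2)).
    by rewrite mulr_natl -sumr_const ler_sum.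
  by rewrite exchange_big mulr_sumr ler_sum.
by rewrite ler_pM2l ?ltr0n// leNgt Ck.
Qed.

End Mean.

(** * Linear maps given by scaled scalar products *)

Section Embedding.
Variables (R : realType) (n N : nat).
Implicit Types (s : R) (h : 'I_N -> 'rV[R]_n) (u v : 'rV[R]_n).

Definition embed s h u : 'rV[R]_N := \row_i (s * dot u (h i)).

Lemma embed_is_linear s h : linear (embed s h).
Proof. by move=> a u v; apply/rowP => i; rewrite !mxE dotDl dotZl; ring. Qed.

HB.instance Definition _ s h :=
  GRing.isLinear.Build R 'rV[R]_n 'rV[R]_N _ (embed s h) (embed_is_linear s h).

Lemma ler_l2norm_scale (c : R) (v w : 'rV[R]_N) : 0 <= c ->
  (forall i, `|v 0 i| <= c * `|w 0 i|) -> l2norm v <= c * l2norm w.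
Proof.
move=> c0 vw; rewrite -(@ler_pXn2r _ 2)// ?nnegrE ?mulr_ge0 ?l2norm_ge0//.
rewrite exprMn !l2norm_sqr mulr_sumr ler_sum// => i _.
rewrite -!expr2 -(real_normK (num_real (v 0 i))) -(real_normK (num_real (w 0 i))).
by rewrite -exprMn lerXn2r ?nnegrE ?mulr_ge0.
Qed.

Lemma l2norm_embed s h u : N%:R * s ^+ 2 = 1 ->
  (forall i, l2norm (h i) <= 2) -> l2norm (embed s h u) <= 2 * l2norm u.
Proof.
move=> Ns h2; apply: (@l2norm_le _ _ (`|s| * (2 * l2norm u))) => [||i].
- by rewrite mulr_ge0 ?l2norm_ge0.
- by rewrite exprMn real_normK ?num_real// mulrA Ns mul1r.
rewrite mxE normrM ler_wpM2l//; apply: le_trans (dot_le _ _) _.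
by rewrite mulrC ler_wpM2r ?l2norm_ge0.
Qed.

(** The squared Hilbert-Schmidt norm, summed over the basis and over the output coordinates. *)
Lemma sum_embed_basis s h :
  \sum_j l2norm (embed s h (delta_mx 0 j)) ^+ 2 =
  s ^+ 2 * \sum_i l2norm (h i) ^+ 2.
Proof.
under eq_bigr do rewrite l2norm_sqr; rewrite exchange_big mulr_sumr /=.
apply: eq_bigr => i _; rewrite l2norm_sqr mulr_sumr; apply: eq_bigr => j _.
rewrite !mxE (_ : dot _ _ = h i 0 j); first by ring.
rewrite /dot (bigD1 j)//= big1 => [|k /negPf kj]; rewrite !mxE ?eqxx ?kj.
  by rewrite mul1r addr0.
by rewrite andbF mul0r.
Qed.

End Embedding.

(** * The random norm: Lipschitz bound, variance and mean *)

Section RandomNorm.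
Variables (R : realType) (n N M : nat) (X : normedModType R).
Variables (f1 f2 : {linear 'rV[R]_N -> X}).
Hypotheses (f1_iso : forall v, `|f1 v| = l2norm v).
Hypotheses (f2_iso : forall v, `|f2 v| = l2norm v).
Variables (g : 'I_M -> 'rV[R]_n) (s : R).
Hypotheses (s0 : 0 <= s) (Ns : N%:R * s ^+ 2 = 1).
Hypothesis g2 : forall i, l2norm (g i) <= 2.
Local Notation T := ('I_M * 'I_M)%type.
Local Notation Omega := {ffun 'I_N -> T}.
Implicit Types (q : 'rV[R]_n * 'rV[R]_n) (x y : Omega).

(** A coordinate of [x] is a pair of indices, one per summand, so the two embeddings are
    independent. *)
Definition rand1 x := embed s (fun i => g (x i).1).
Definition rand2 x := embed s (fun i => g (x i).2).
Definition rand_sum q x := f1 (rand1 x q.1) + f2 (rand2 x q.2).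
Definition rand_norm q x := `|rand_sum q x|.

Lemma rand_sum_dist q x q' x' : `|rand_sum q x - rand_sum q' x'| <=
  l2norm (rand1 x q.1 - rand1 x' q'.1) + l2norm (rand2 x q.2 - rand2 x' q'.2).
Proof.
rewrite /rand_sum opprD addrACA -!linearB -f1_iso -f2_iso; exact: ler_normD.
Qed.

Lemma rand_norm_lip q q' x : `|rand_norm q x - rand_norm q' x| <=
  2 * (l2norm (q.1 - q'.1) + l2norm (q.2 - q'.2)).
Proof.
apply: le_trans (ler_dist_dist _ _) _; apply: le_trans (rand_sum_dist _ _ _ _) _.
by rewrite /rand1 /rand2 -!linearB mulrDr lerD// l2norm_embed.
Qed.

(** Resampling coordinate [k] moves the vector by [d k], which in each summand is a multiple of the
    image of the [k]-th basis vector. Since two values of [g] differ by at most 4, [norm_drop_sqr]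
    applies with L = 4 s (|u| + |v|), and the variance is of order s^2 = 1/N. *)
Lemma rand_norm_var q : \sum_x (rand_norm q x - mean (rand_norm q)) ^+ 2 <=
  #|Omega|%:R * (4 * s * (l2norm q.1 + l2norm q.2)) ^+ 2.
Proof.
apply: efron_stein => x y.
pose z k : Omega := [ffun i => if i == k then y i else x i].
pose d k := rand_sum q x - rand_sum q (z k).
rewrite (eq_bigr (fun k => Num.max 0 (`|rand_sum q x| -
    `|rand_sum q x - d k|) ^+ 2)) => [|k _]; last by rewrite subKr.
apply: norm_drop_sqr => [|w]; first by rewrite !mulr_ge0// addr_ge0 ?l2norm_ge0.
have -> : \sum_i w 0 i *: d i =
    f1 (\row_i (w 0 i * (s * dot q.1 (g (x i).1 - g (y i).1)))) +
    f2 (\row_i (w 0 i * (s * dot q.2 (g (x i).2 - g (y i).2)))).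
  have rowE (F : 'I_N -> R) : \row_i (w 0 i * F i) =
      \sum_k w 0 k *: \row_i (if i == k then F i else 0) :> 'rV[R]_N.
    apply/rowP => i; rewrite summxE (bigD1 i)//= big1 => [|k /negPf ki].
      by rewrite !mxE eqxx addr0.
    by rewrite !mxE eq_sym ki mulr0.
  rewrite !rowE !linear_sum -big_split; apply: eq_bigr => k _ /=.
  rewrite !linearZ -scalerDr; congr (_ *: _).
  rewrite /d /rand_sum opprD addrACA -!linearB; congr (f1 _ + f2 _);
  by apply/rowP => i; rewrite !mxE !ffunE; case: ifP => _;
     rewrite ?subrr// dotBr; ring.
apply: le_trans (ler_normD _ _) _; rewrite f1_iso f2_iso mulrDr mulrDl.
have bnd (v : 'rV[R]_n) (a b : 'I_N -> 'I_M) :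
    l2norm (\row_i (w 0 i * (s * dot v (g (a i) - g (b i))))) <=
    4 * s * l2norm v * l2norm w.
  apply: ler_l2norm_scale => [|i]; first by rewrite !mulr_ge0 ?l2norm_ge0.
  rewrite mxE normrM mulrC ler_wpM2r// normrM (ger0_norm s0).
  rewrite (mulrC 4) -mulrA ler_wpM2l//; apply: le_trans (dot_le _ _) _.
  rewrite mulrC ler_wpM2r ?l2norm_ge0//.
  apply: le_trans (ler_l2normD _ _) _; rewrite -[in l2norm (- _)]scaleN1r l2normZ.
  by have := g2 (a i); have := g2 (b i); rewrite normrN1; lra.
exact: lerD.
Qed.

(** Applying [p1] and [p2] to the index pairs permutes [Omega] and preserves the mean, while each
    embedded vector moves by at most [2 * delta] times the length of its source. *)
Lemma rand_norm_mean (delta : R) q q' : 0 <= delta ->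
  (forall u v, l2norm u = l2norm v ->
     exists2 p : 'I_M -> 'I_M, injective p &
       forall i, `|dot u (g i) - dot v (g (p i))| <= 2 * delta * l2norm u) ->
  l2norm q.1 = l2norm q'.1 -> l2norm q.2 = l2norm q'.2 ->
  `|mean (rand_norm q) - mean (rand_norm q')| <=
    2 * delta * (l2norm q.1 + l2norm q.2).
Proof.
move=> delta0 gP /gP[p1 p1I p1P] /gP[p2 p2I p2P].
pose p x : Omega := [ffun i => (p1 (x i).1, p2 (x i).2)].
have pI : injective p.
  move=> x y /ffunP pxy; apply/ffunP => i; have := pxy i; rewrite !ffunE.
  by case: (x i) (y i) => [a b] [c d] /= [/p1I-> /p2I->].
rewrite -(mean_reindex (rand_norm q') pI).
apply: ler_mean_dist => [|x]; first by rewrite !mulr_ge0// addr_ge0 ?l2norm_ge0.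
apply: le_trans (ler_dist_dist _ _) _; apply: le_trans (rand_sum_dist _ _ _ _) _.
have bnd (c : R) (a b : 'rV[R]_n) (h k : 'I_N -> 'I_M) : 0 <= c ->
    (forall i, `|dot a (g (h i)) - dot b (g (k i))| <= c) ->
    l2norm (embed s (fun i => g (h i)) a - embed s (fun i => g (k i)) b) <= c.
  move=> c0 hk; apply: (@l2norm_le _ _ (s * c)) => [//||i].
    by rewrite exprMn mulrA Ns mul1r.
  by rewrite !mxE -mulrBr normrM (ger0_norm s0) ler_wpM2l.
rewrite mulrDr lerD// ?bnd ?mulr_ge0 ?l2norm_ge0// => i; rewrite ffunE.
- exact: p1P.
- exact: p2P.
Qed.

End RandomNorm.

(** * A nearly invariant pair of embeddings *)

Section NearInvariance.
Variable R : realType.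

Lemma l2norm_rV0 (u : 'rV[R]_0) : l2norm u = 0.
Proof. by rewrite [u]thinmx0 l2norm0. Qed.

(** For n > 0, the squared lengths of the images of the basis vectors add up to at least 1/4, so one
    image has length at least 1/(2n). Near-invariance carries this bound to every direction. *)
Lemma embed_lower n N (s eta : R) (h : 'I_N -> 'rV[R]_n) (u : 'rV[R]_n) :
  N%:R * s ^+ 2 = 1 -> (forall i, 2^-1 <= l2norm (h i)) ->
  (forall v v' : 'rV[R]_n, l2norm v = l2norm v' ->
     l2norm (embed s h v) - l2norm (embed s h v') <= eta * l2norm v) ->
  ((2 * n%:R)^-1 - eta) * l2norm u <= l2norm (embed s h u).
Proof.
move=> Ns h2 hinv; case: n u h h2 hinv => [|n] u h h2 hinv.
  by rewrite l2norm_rV0 mulr0 l2norm_ge0.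
have [j jP] : exists j, (2 * n.+1%:R)^-1 <= l2norm (embed s h (delta_mx 0 j)).
  apply: contrapT => nj.
  have lt j : l2norm (embed s h (delta_mx 0 j)) < (2 * n.+1%:R)^-1.
    by rewrite ltNge; apply/negP => le; apply: nj; exists j.
  have : 4^-1 <= \sum_j l2norm (embed s h (delta_mx 0 j)) ^+ 2.
    have -> : 4^-1 = s ^+ 2 * \sum_(i < N) 4^-1 :> R.
      by rewrite sumr_const card_ord -(mulr_natl 4^-1) mulrA (mulrC (s ^+ 2)) Ns mul1r.
    rewrite sum_embed_basis ler_wpM2l ?sqr_ge0// ler_sum// => i _.
    by have := h2 i; nra.
  apply/negP; rewrite -ltNge.
  apply: (@lt_le_trans _ _ (\sum_(j < n.+1) (2 * n.+1%:R)^-1 ^+ 2 : R)).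
    apply: ltr_sum => [|j _]; last by rewrite ltrXn2r ?l2norm_ge0.
    by apply/hasP; exists ord0; rewrite ?mem_index_enum.
  rewrite sumr_const card_ord -(mulr_natl (_ ^+ 2)).
  have n1 : 1 <= n.+1%:R :> R by rewrite ler1n.
  rewrite (_ : _ * _ = 4^-1 / n.+1%:R); last by field; rewrite gt_eqF ?ltr0n.
  by rewrite ler_pdivrMr ?ltr0n//; lra.
have e : l2norm (l2norm u *: delta_mx 0 j : 'rV[R]_n.+1) = l2norm u.
  by rewrite l2normZ l2norm_delta mulr1 ger0_norm ?l2norm_ge0.
have := hinv _ _ e; rewrite e linearZ /= l2normZ ger0_norm ?l2norm_ge0// => h1.
have := ler_wpM2l (l2norm_ge0 u) jP; move: h1.
by set c := (2 * _)^-1; lra.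
Qed.

(** The design, the net and the variance bound do not involve [X], so [N] can be fixed first.
    Concentration on the net extends to the unit balls by the Lipschitz bound, then to all vectors
    by homogeneity. *)
Lemma near_invariant_embedding (n : nat) (eta : R) : 0 < eta ->
  exists N : nat, forall (X : normedModType R) (f1 f2 : {linear 'rV[R]_N -> X}),
    (forall v, `|f1 v| = l2norm v) -> (forall v, `|f2 v| = l2norm v) ->
    exists U1 U2 : {linear 'rV[R]_n -> 'rV[R]_N},
      [/\ forall u, ((2 * n%:R)^-1 - eta) * l2norm u <= l2norm (U1 u),
          forall u, ((2 * n%:R)^-1 - eta) * l2norm u <= l2norm (U2 u)
        & forall u v u' v', l2norm u = l2norm u' -> l2norm v = l2norm v' ->
            `|f1 (U1 u) + f2 (U2 v)| - `|f1 (U1 u') + f2 (U2 v')| <=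
            eta * (l2norm u + l2norm v)].
Proof.
move=> eta0; case: n => [|n0].
  exists 0 => X f1 f2 _ _; exists (embed 0 (fun=> 0)), (embed 0 (fun=> 0)).
  split=> [u|u|u v u' v' _ _]; rewrite !l2norm_rV0 ?mulr0//.
  by rewrite (thinmx0 u) (thinmx0 v) (thinmx0 u') (thinmx0 v') subrr addr0 mulr0.
set n := n0.+1.
(* 22 = 9 + 9 + 4: two deviations from the mean, bounded in [near], and one difference of means. *)
pose kappa := eta / 22; have kappa0 : 0 < kappa by rewrite divr_gt0.
pose delta := Num.min kappa 2^-1.
have delta0 : 0 < delta by rewrite lt_min kappa0 invr_gt0 ltr0n.
have [dk d2] : delta <= kappa /\ delta <= 2^-1 by rewrite !ge_min !lexx orbT.
have [M [g [/(_ isT) M0 g1 gP]]] := @sphere_design R n _ delta0.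
have g2 i : l2norm (g i) <= 2 by have /andP[_] := g1 i; lra.
have gl i : 2^-1 <= l2norm (g i) by have /andP[+ _] := g1 i; lra.
have [D DP] := @ball_net R n _ kappa0.
pose Q := [seq (u, v) | u <- D, v <- D].
pose K := \sum_(q <- Q) (4 * (l2norm q.1 + l2norm q.2)) ^+ 2.
(* Taking N = m^2 makes 1 / sqrt N equal to 1/m. The variance bounds on the net add up to K / m^2 <=
   K / m < kappa^2. *)
pose m := (Num.truncn (K / kappa ^+ 2)).+1.
have m0 : 0 < m%:R :> R by rewrite ltr0n.
pose s : R := m%:R^-1; have s0 : 0 <= s by rewrite invr_ge0 ltW.
pose N := (m * m)%N; exists N => X f1 f2 f1_iso f2_iso.
have Ns : N%:R * s ^+ 2 = 1 by rewrite /s natrM; field; rewrite gt_eqF.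
pose Z := @rand_norm R n N M X f1 f2 g s.
have om0 : (0 < #|{ffun 'I_N -> 'I_M * 'I_M}|)%N.
  by apply/card_gt0P; exists [ffun=> (Ordinal M0, Ordinal M0)].
have [x xP] : exists x, forall q, q \in Q -> `|Z q x - mean (Z q)| <= kappa.
  apply: near_means (fun q => rand_norm_var f1_iso f2_iso s0 g2 q) _ => //.
    exact: ltW.
  rewrite (eq_bigr (fun q => s ^+ 2 * (4 * (l2norm q.1 + l2norm q.2)) ^+ 2));
    last by move=> q _; ring.
  rewrite -mulr_sumr -/K /s exprVn mulrC ltr_pdivrMr ?exprn_gt0//.
  rewrite mulrC -ltr_pdivrMr ?exprn_gt0//.
  apply: (@lt_le_trans _ _ m%:R); first exact: truncnS_gt.
  by rewrite -natrX ler_nat -mulnn leq_pmull.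
(* 9 = 4 + 1 + 4: passage to a net point, its deviation, and the passage back for the means. *)
have near u v : l2norm u <= 1 -> l2norm v <= 1 ->
    `|Z (u, v) x - mean (Z (u, v))| <= 9 * kappa.
  move=> /DP[u' u'D uu'] /DP[v' v'D vv'].
  have qQ : (u', v') \in Q by apply/allpairsP; exists (u', v').
  have lip y : `|Z (u, v) y - Z (u', v') y| <= 4 * kappa.
    by apply: le_trans (rand_norm_lip f1_iso f2_iso Ns g2 _ _ _) _ => /=; lra.
  have lipm : `|mean (Z (u, v)) - mean (Z (u', v'))| <= 4 * kappa.
    by apply: ler_mean_dist lip; lra.
  have := lip x; have := xP _ qQ; move: lipm.
  by rewrite !ler_distl => /andP[? ?] /andP[? ?] /andP[? ?]; apply/andP; split; lra.
have inv1 u v u' v' : l2norm u = l2norm u' -> l2norm v = l2norm v' ->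
    l2norm u <= 1 -> l2norm v <= 1 -> Z (u, v) x - Z (u', v') x <= eta.
  move=> uu' vv' u1 v1.
  have h1 := near _ _ u1 v1; rewrite uu' in u1; rewrite vv' in v1.
  have h2 := near _ _ u1 v1.
  have := rand_norm_mean f1_iso f2_iso s0 Ns (ltW delta0) gP
    (q := (u, v)) (q' := (u', v')) uu' vv'.
  rewrite -/Z /=.
  have : 2 * delta * (l2norm u + l2norm v) <= 4 * kappa.
    rewrite -uu' -vv' in u1 v1.
    have := l2norm_ge0 u; have := l2norm_ge0 v; nra.
  have ek : eta = 22 * kappa by rewrite /kappa; field.
  move: h1 h2.
  by rewrite !ler_distl => /andP[? ?] /andP[? ?] ? /andP[? ?]; lra.
have ZZ t u v : 0 <= t -> Z (t *: u, t *: v) x = t * Z (u, v) x.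
  move=> t0; rewrite /Z /rand_norm /rand_sum /rand1 /rand2 /= !linearZ -scalerDr.
  by rewrite normrZ ger0_norm.
have inv u v u' v' : l2norm u = l2norm u' -> l2norm v = l2norm v' ->
    Z (u, v) x - Z (u', v') x <= eta * (l2norm u + l2norm v).
  (* Division by [t] brings both vectors into the unit ball. *)
  move=> uu' vv'; set t := l2norm u + l2norm v.
  have [u0 v0] := (l2norm_ge0 u, l2norm_ge0 v).
  have [t0|t0] := eqVneq t 0.
    have eu : l2norm u = 0 by rewrite /t in t0; lra.
    have ev : l2norm v = 0 by rewrite /t in t0; lra.
    rewrite t0 mulr0 (l2norm_eq0 eu) (l2norm_eq0 ev).
    by rewrite uu' in eu; rewrite vv' in ev; rewrite (l2norm_eq0 eu) (l2norm_eq0 ev) subrr.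
  have tp : 0 < t by rewrite lt_def t0 addr_ge0.
  have tV (w : 'rV[R]_n) : l2norm (t^-1 *: w) = l2norm w / t.
    by rewrite l2normZ ger0_norm ?invr_ge0 1?ltW// mulrC.
  have := inv1 (t^-1 *: u) (t^-1 *: v) (t^-1 *: u') (t^-1 *: v').
  rewrite !tV uu' vv' => /(_ erefl erefl).
  rewrite -uu' -vv' !ler_pdivrMr// !mul1r lerDl lerDr => /(_ v0 u0).
  have tV0 : 0 <= t^-1 by rewrite invr_ge0 ltW.
  by rewrite !ZZ// -mulrBr mulrC ler_pdivrMr.
(* With one vector zero, [Z] is the length of a single embedded vector, so [inv] yields the
   near-invariance required by [embed_lower]. *)
have ZZ1 u : Z (u, 0) x = l2norm (rand1 g s x u).
  by rewrite /Z /rand_norm /rand_sum /rand2 !linear0 addr0 f1_iso.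
have ZZ2 u : Z (0, u) x = l2norm (rand2 g s x u).
  by rewrite /Z /rand_norm /rand_sum /rand1 !linear0 add0r f2_iso.
exists (embed s (fun i => g (x i).1)), (embed s (fun i => g (x i).2)).
split=> [u|u|]; last exact: inv.
  apply: embed_lower => // v v' vv'.
  by have := inv v 0 v' 0 vv' erefl; rewrite !ZZ1 l2norm0 addr0.
apply: embed_lower => // v v' vv'.
by have := inv 0 v 0 v' erefl vv'; rewrite !ZZ2 l2norm0 add0r.
Qed.

End NearInvariance.

(** * Ranges as subspaces, inner products and projection bounds *)

Section Subspaces.
Variables (R : realType) (X : normedModType R).

Lemma linear_subspace_range n (f : {linear 'rV[R]_n -> X}) :
  linear_subspace (range f).
Proof.
split=> [|a x y]; first by rewrite inE; exists 0; rewrite ?linear0.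
rewrite !inE => -[u _ <-] [v _ <-]; exists (a *: u + v) => //.
by rewrite linearP.
Qed.

Lemma subspace_of_dim_range n (f : {linear 'rV[R]_n -> X}) :
  (forall u, f u = 0 -> u = 0) -> subspace_of_dim n (range f).
Proof.
move=> f0.
have fE (c : 'I_n -> R) : \sum_i c i *: f (delta_mx 0 i) = f (\row_i c i).
  rewrite [\row_i c i]row_sum_delta linear_sum; apply: eq_bigr => i _.
  by rewrite linearZ mxE.
exists (fun i => f (delta_mx 0 i)); split=> [c|].
  by rewrite fE => /f0/rowP c0 i; have := c0 i; rewrite !mxE.
apply/seteqP; split=> [_ [u _ <-]|_ [c ->]]; last by rewrite fE; exists (\row_i c i).
by exists (fun i => u 0 i); rewrite fE; congr (f _); apply/rowP => i; rewrite mxE.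
Qed.

(** It depends on the norm of [X] alone, so one formula serves as inner product on both summands. *)
Definition polarization (x y : X) : R := (`|x + y| ^+ 2 - `|x - y| ^+ 2) / 4.

Lemma euclidean_on_range N (f : {linear 'rV[R]_N -> X}) (Y : set X) :
  (forall v, `|f v| = l2norm v) -> Y `<=` range f ->
  euclidean_on Y polarization.
Proof.
move=> fiso Yf.
have ipE u v : polarization (f u) (f v) = dot u v.
  rewrite /polarization -linearB -linearD !fiso !l2norm_sqr.
  by rewrite !(dotBl, dotBr, dotDl, dotDr) (dotC v u); field.
have fP x : x \in Y -> exists u, x = f u.
  by rewrite inE => /Yf[u _ <-]; exists u.
split; first split=> [x y /fP[u ->] /fP[v ->]|a x y z /fP[u ->] /fP[v ->] /fP[w ->]|x /fP[u ->] u0].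
- by rewrite !ipE dotC.
- by rewrite -linearP !ipE dotDl dotZl.
- rewrite ipE lt_def dot_ge0 andbT; apply: contra_neq u0 => /dot_eq0 ->.
  by rewrite linear0.
- by move=> x /fP[u ->]; rewrite ipE fiso l2normE.
Qed.

(** [opnorm] tests the unit ball, so [x1 + x2] is scaled to length 1; [Px] records homogeneity along
    its line. *)
Lemma opnorm_component (P : X -> X) (x1 x2 : X) (A : R) :
  (forall t : R, P (t *: (x1 + x2)) = t *: x1) -> (opnorm P <= A%:E)%E ->
  `|x1| <= A * `|x1 + x2|.
Proof.
move=> Px PA; have [x0|x0] := eqVneq (x1 + x2) 0.
  have := Px 1; have := Px 0; rewrite x0 !scaler0 scale0r scale1r => -> <-.
  by rewrite normr0 mulr0.
have x0' : 0 < `|x1 + x2| by rewrite normr_gt0.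
set t := `|x1 + x2| in x0' *.
have tV : `|t^-1| = t^-1 by rewrite ger0_norm// invr_ge0 ltW.
have : (`|P (t^-1 *: (x1 + x2))|%:E <= opnorm P)%E.
  apply: ereal_sup_ubound; exists (t^-1 *: (x1 + x2)) => //=.
  by rewrite normrZ tV mulVf ?gt_eqF.
move=> /le_trans/(_ PA); rewrite lee_fin Px normrZ tV.
by rewrite mulrC ler_pdivrMr.
Qed.

(** An orthogonal operator preserves the length of [U u], but the preimage [u'] of the result may
    differ in length from [u]. Rescaling [u'] to the length of [u] moves [U u'] along its own line,
    by the difference of two image lengths, which near-invariance bounds. *)
Lemma rescale_l2norm n N (U : {linear 'rV[R]_n -> 'rV[R]_N}) (b eta : R)
    (u u' : 'rV[R]_n) : 0 < b ->
  (forall w, b * l2norm w <= l2norm (U w)) ->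
  (forall w w', l2norm w = l2norm w' ->
     `|l2norm (U w) - l2norm (U w')| <= eta * l2norm w) ->
  l2norm (U u') = l2norm (U u) ->
  exists2 w, l2norm w = l2norm u & l2norm (U u' - U w) <= eta * l2norm u.
Proof.
move=> b0 bU Uinv Uu.
have u'0 : l2norm u' = 0 -> l2norm u = 0.
  move=> /l2norm_eq0 e; have := bU u; rewrite -Uu e linear0 l2norm0.
  by rewrite pmulr_rle0// => h; apply/eqP; rewrite eq_le h l2norm_ge0.
(* If [u'] is zero then [t = 0], since division by 0 gives 0; this agrees with [u'0]. *)
pose t := l2norm u / l2norm u'; have t0 : 0 <= t by rewrite divr_ge0 ?l2norm_ge0.
have tu' : l2norm (t *: u') = l2norm u.
  rewrite l2normZ ger0_norm//; have [e|e] := eqVneq (l2norm u') 0.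
    by rewrite e mulr0 u'0.
  by rewrite divfK.
exists (t *: u') => //; have := Uinv _ _ tu'; rewrite tu' -Uu.
rewrite linearZ /= -[X in l2norm (X - _)]scale1r -scalerBl !l2normZ (ger0_norm t0).
by rewrite -[X in `|t * _ - X|]mul1r -mulrBl normrM (ger0_norm (l2norm_ge0 _)) distrC.
Qed.

End Subspaces.

(** * From nearly invariant embeddings to invariant subspaces *)

Theorem theorem2p2 (R : realType) (n : nat) (eps A : R)
    (heps0 : 0 < eps) (heps1 : eps < 1) (hA : 1 <= A) :
  exists N : nat,
    forall (X : normedModType R) (X1 X2 : set X) (P1 P2 : X -> X),
      direct_sum_decomposition X1 X2 ->
      isometric_l2 N X1 -> isometric_l2 N X2 ->
      direct_sum_projections X1 X2 P1 P2 ->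
      (opnorm P1 <= A%:E)%E -> (opnorm P2 <= A%:E)%E ->
      exists Y1 Y2 : set X,
        [/\ Y1 `<=` X1, Y2 `<=` X2,
            subspace_of_dim n Y1, subspace_of_dim n Y2
          & eps_invariant eps Y1 Y2].
Proof.
(* Half of 1/(2(n+1)), so 1/(2n) - eta >= b once eta <= b; n + 1 keeps [b] positive for n = 0. *)
pose b : R := (4 * n.+1%:R)^-1.
have b0 : 0 < b by rewrite invr_gt0 mulr_gt0 ?ltr0n.
(* Chosen so that [eta * (2 * A / b) = eps / 2]; two errors of this size are incurred below. *)
pose eta := eps * b / (4 * A).
have eta0 : 0 < eta by rewrite divr_gt0 ?mulr_gt0//; lra.
have etab : eta <= b.
  by rewrite ler_pdivrMr; [nra|lra].
have bn (u : 'rV[R]_n) : b * l2norm u <= ((2 * n%:R)^-1 - eta) * l2norm u.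
  have [n0|n0] := posnP n.
    suff -> : u = 0 by rewrite l2norm0 !mulr0.
    by apply/rowP => i; have := leq_ltn_trans (leq0n i) (ltn_ord i); rewrite {1}n0.
  rewrite ler_wpM2r ?l2norm_ge0//.
  have : 2 * b <= (2 * n%:R)^-1.
    rewrite (_ : 2 * b = (2 * n.+1%:R)^-1); last by rewrite /b; field; rewrite gt_eqF ?ltr0n.
    by rewrite lef_pV2 ?posrE ?mulr_gt0 ?ltr0n// ler_pM2l// ler_nat.
  by move: etab; set c := (2 * n%:R)^-1; lra.
have [N NP] := near_invariant_embedding n eta0.
exists N => X X1 X2 P1 P2 [[_ _ X120] _] [f1 [f1i X1E]] [f2 [f2i X2E]].
move: X120; rewrite -X1E -X2E => X120 PP P1A P2A.
have [U1 [U2 [U1l U2l UU]]] := NP X f1 f2 f1i f2i.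
have bU1 u : b * l2norm u <= l2norm (U1 u) by exact: le_trans (bn u) (U1l u).
have {bn} bU2 u : b * l2norm u <= l2norm (U2 u) by exact: le_trans (bn u) (U2l u).
have inv u v u' v' : l2norm u = l2norm u' -> l2norm v = l2norm v' ->
    `| `|f1 (U1 u) + f2 (U2 v)| - `|f1 (U1 u') + f2 (U2 v')| | <=
      eta * (l2norm u + l2norm v).
  move=> uu' vv'; rewrite ler_norml UU// lerNl opprB.
  by rewrite uu' vv' UU.
have inv1 u u' : l2norm u = l2norm u' ->
    `|l2norm (U1 u) - l2norm (U1 u')| <= eta * l2norm u.
  by move=> uu'; have := inv u 0 u' 0 uu' erefl; rewrite !linear0 !addr0 !f1i l2norm0 addr0.
have inv2 u u' : l2norm u = l2norm u' ->
    `|l2norm (U2 u) - l2norm (U2 u')| <= eta * l2norm u.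
  by move=> uu'; have := inv 0 u 0 u' erefl uu'; rewrite !linear0 !add0r !f2i l2norm0 add0r.
(* The projection bounds and the lower bounds on [U1], [U2] turn errors relative to the lengths of
   [u] and [v] into errors relative to the norm of the sum. *)
have comp (u v : 'rV[R]_n) : l2norm u + l2norm v <=
    (2 * A / b) * `|f1 (U1 u) + f2 (U2 v)|.
  have PPt t : P1 (t *: (f1 (U1 u) + f2 (U2 v))) = t *: f1 (U1 u) /\
               P2 (t *: (f1 (U1 u) + f2 (U2 v))) = t *: f2 (U2 v).
    by rewrite scalerDr -!linearZ /=; apply: PP; eexists.
  have h1 := opnorm_component (fun t => (PPt t).1) P1A.
  have : `|f2 (U2 v)| <= A * `|f2 (U2 v) + f1 (U1 u)|.
    apply: opnorm_component P2A => t; rewrite addrC; exact: (PPt t).2.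
  rewrite addrC; rewrite f1i in h1; rewrite f2i => h2.
  have := bU1 u; have := bU2 v.
  rewrite mulrAC ler_pdivlMr//; lra.
pose F1 : {linear 'rV[R]_n -> X} := f1 \o U1.
pose F2 : {linear 'rV[R]_n -> X} := f2 \o U2.
have F1X : range F1 `<=` range f1 by move=> _ [u _ <-]; exists (U1 u).
have F2X : range F2 `<=` range f2 by move=> _ [u _ <-]; exists (U2 u).
have inj (U : {linear 'rV[R]_n -> 'rV[R]_N}) (f : {linear 'rV[R]_N -> X}) u :
    (forall v, `|f v| = l2norm v) -> b * l2norm u <= l2norm (U u) ->
    f (U u) = 0 -> u = 0.
  move=> fi bU fU; apply: l2norm_eq0; move: bU; rewrite -fi fU normr0.
  by rewrite pmulr_rle0// => h; apply/eqP; rewrite eq_le h l2norm_ge0.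
have E1 := euclidean_on_range f1i F1X.
have E2 := euclidean_on_range f2i F2X.
exists (range F1), (range F2); split=> //.
- by apply: subspace_of_dim_range => u; apply: inj.
- by apply: subspace_of_dim_range => u; apply: inj.
split.
  split; [exact: linear_subspace_range|exact: linear_subspace_range|].
  apply/seteqP; split=> [x [/F1X x1 /F2X x2]|_ ->].
    suff : (range f1 `&` range f2) x by rewrite X120.
    by split.
  by split; exists 0; rewrite ?linear0.
exists (polarization (X := X)), (polarization (X := X)); split=> //.
move=> O1 O2 O1o O2o y1 y2 Yy1 Yy2.
(* Orthogonality enters as invariance of [Y] and preservation of the norm, so the images of [y1],
   [y2] come from some [u'], [v'] with image lengths unchanged. *)
have normO (Y : set X) (O : X -> X) y : euclidean_on Y (polarization (X := X)) ->
    orthogonal_on Y (polarization (X := X)) O -> Y y -> Y (O y) /\ `|O y| = `|y|.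
  move=> [_ nE] [_ OY Oip] Yy.
  have YO : Y (O y) by rewrite -OY; exists y.
  by split=> //; rewrite !nE ?inE// Oip ?inE.
have [Y1 n1] := normO _ _ _ E1 O1o Yy1.
have [Y2 n2] := normO _ _ _ E2 O2o Yy2.
case: Yy1 Y1 n1 => u _ <- [u' _ <-]; rewrite /= !f1i => n1.
case: Yy2 Y2 n2 => v _ <- [v' _ <-]; rewrite /= !f2i => n2.
have [w1 w1n w1d] := rescale_l2norm b0 bU1 inv1 n1.
have [w2 w2n w2d] := rescale_l2norm b0 bU2 inv2 n2.
(* [d1] is the cost of replacing [u'], [v'] by [w1], [w2], whose lengths are those of [u], [v]; [d2]
   is near-invariance for the latter. *)
have d1 : `| `|f1 (U1 u') + f2 (U2 v')| - `|f1 (U1 w1) + f2 (U2 w2)| | <=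
    eta * (l2norm u + l2norm v).
  apply: le_trans (ler_dist_dist _ _) _.
  rewrite opprD addrACA -!linearB; apply: le_trans (ler_normD _ _) _.
  by rewrite f1i f2i mulrDr !linearB lerD.
have d2 := inv _ _ _ _ w1n w2n; rewrite w1n w2n in d2.
have := comp u v; rewrite -(ler_pM2l eta0) => c.
have e4 : eta * (2 * A / b) = eps / 2.
  by rewrite /eta; field; rewrite !gt_eqF//; lra.
rewrite mulrA e4 in c.
move: d1 d2; rewrite !ler_distl => /andP[? ?] /andP[? ?].
split; lra.
Qed.
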